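(* Let $n>2$ and let $U$ be $F_{(n_1,\dots,n_\ell)}$ with $n_1\cdots n_\ell=n$, or more generally any $n\times n$ unitary matrix all of whose first-row entries equal $1/\sqrt n$. Then: (1) The ideal heralding rate is $$h_n(0)=\left(\frac{-1}{n}\right)^{n-1}(n-1)!\sum_{t=0}^{n-1}(n-t)\frac{(-n)^t}{t!}={}_2F_0\!\left(-(n-1),2;\tfrac1n\right),$$ where ${}_2F_0(a,b;z)=\sum_{j\ge0}\frac{(a)_j(b)_j}{j!}z^j$ and $(a)_j=a(a+1)\cdots(a+j-1)$. (2) $\lim_{n\to\infty}h_n(0)=\tfrac14$.
   Context: Here $F_m=\frac1{\sqrt m}(e^{2\pi ijk/m})_{j,k}$, $F_{(n_1,\dots,n_\ell)}=F_{n_1}\otimes\cdots\otimes F_{n_\ell}$ with modes labelled so that $|m_1\rangle\otimes\cdots\otimes|m_\ell\rangle$ is mode $m_1+n_1m_2+\cdots+(n_1\cdots n_{\ell-1})m_\ell$. For an $n\times n$ unitary $U$, $\hat U$ is the induced linear optical unitary on $n$ bosons in $n$ modes ($a_j^\dagger\mapsto\sum_iU_{ij}a_i^\dagger$), and $|s_0,\dots,s_{n-1}\rangle$ denotes Fock states. An ideal pattern is $(s_0,\dots,s_{n-1})$ with $\sum s_i=n$, $s_0=1$ and $\langle s_0,\dots,s_{n-1}|\hat U|1,\dots,1\rangle\ne0$. The ideal heralding rate is $h_n(0)=\sum_{s\text{ ideal}}|\langle s|\hat U|1,\dots,1\rangle|^2$, the probability that measuring the photon numbers of $\hat U|1,\dots,1\rangle$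 in all modes yields an ideal pattern. *)

(* Defs.v *)
From HB Require Import structures.
From mathcomp Require Import all_boot all_order all_algebra.
From mathcomp Require Import all_classical all_reals all_analysis.
From mathcomp Require Export complex.
Set Implicit Arguments. Unset Strict Implicit. Unset Printing Implicit Defensive.
Import Order.TTheory GRing.Theory Num.Theory.
Local Open Scope ring_scope.

Section Boson.
Variable R : realType.
Local Notation C := R[i].

Definition adjoint n (U : 'M[C]_n) : 'M[C]_n := (map_mx (@conjc R) U)^T.
Definition unitary n (U : 'M[C]_n) : Prop := U *m adjoint U = 1%:M.

Definition first_row_uniform n (U : 'M[C]_n) : Prop :=
  forall i j : 'I_n, nat_of_ord i = 0%N ->
    U i j = Complex ((Num.sqrt (n%:R : R))^-1) 0.

Definition abs2 (z : C) : R := complex.Re z ^+ 2 + complex.Im z ^+ 2.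

(* number of input photons sent to output mode i by the assignment f
   (input photon in mode j goes to output mode f j) *)
Definition occ n (f : {ffun 'I_n -> 'I_n}) (i : 'I_n) : nat := #|[pred j | f j == i]|.

(* Fock amplitude <s_0,...,s_{n-1}| U^ |1,...,1>, obtained by expanding
   U^ |1..1> = prod_j (sum_i U_ij a_i^dag) |0> and using
   prod_i (a_i^dag)^{s_i} |0> = sqrt(prod_i s_i!) |s>. *)
Definition fock_amp n (U : 'M[C]_n) (s : 'I_n -> nat) : C :=
  Complex (Num.sqrt ((\prod_(i < n) (s i)`!)%:R : R)) 0 *
  \sum_(f : {ffun 'I_n -> 'I_n} | [forall i, occ f i == s i]) \prod_(j < n) U (f j) j.

Definition ideal n (U : 'M[C]_n) (s : 'I_n -> nat) : bool :=
  [&& (\sum_(i < n) s i == n)%N,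
      [forall i : 'I_n, (nat_of_ord i == 0%N) ==> (s i == 1%N)] &
      fock_amp U s != 0].

(* patterns with total photon number n have entries <= n, so they are
   enumerated exactly by {ffun 'I_n -> 'I_n.+1} *)
Definition pat n (s : {ffun 'I_n -> 'I_n.+1}) : 'I_n -> nat := fun i => nat_of_ord (s i).

Definition heralding_rate n (U : 'M[C]_n) : R :=
  \sum_(s : {ffun 'I_n -> 'I_n.+1} | ideal U (pat s)) abs2 (fock_amp U (pat s)).

End Boson.

Definition hclosed (R : realType) (n : nat) : R :=
  (- 1 / n%:R) ^+ n.-1 * (n.-1)`!%:R *
  \sum_(t < n) (n - t)%:R * (- n%:R) ^+ t / t`!%:R.

Definition pochhammer (R : realType) (a : R) (j : nat) : R :=
  \prod_(k < j) (a + k%:R).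

Definition hyp2F0_partial (R : realType) (a b z : R) (N : nat) : R :=
  \sum_(j < N) pochhammer a j * pochhammer b j / j`!%:R * z ^+ j.

(* Main.v *)
Require Import Defs.
From HB Require Import structures.
From mathcomp Require Import all_boot all_order all_algebra all_fingroup.
From mathcomp Require Import all_classical all_reals all_analysis.
From mathcomp Require Import complex ring lra.
Import Order.TTheory GRing.Theory Num.Theory numFieldNormedType.Exports.
Local Open Scope ring_scope.

(* The rate is the probability that mode 0 contains exactly one photon, i.e. the
   coefficient of x in the generating function of the photon number of mode 0.
   Expanding the square of an amplitude as a sum over permutations, that generating
   function is the permanent of U^* diag(x, 1, .., 1) U = I + ((x - 1) / n) J,
   where J is the all-ones matrix, since U is unitary with uniform first row; the
   permanent of I + y J is the sum of the n^_k y^k.  Hence the rate is the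
   alternating sum of (-1)^j (j + 1) a_j with a_j = (n - 1)^_j / n^j.

   Let L p be the sum of (-1)^j p(j + 1) a_j.  As a_j - a_(j+1) = (j + 1) a_j / n,
   summation by parts gives L (p(m) + p(m - 1)) = p(0) + L (m p(m)) / n.  Solving
   p(m) + p(m - 1) = m^k for k = 1, .., 4 expresses L m^k through moments that are
   smaller by a factor n; the non-alternating moments of m, m^3 and m^5 are
   bounded by n, 2 n^2 and 8 n^3, and combining these gives
   L m = 1 / 4 + O(1 / n). *)

Set Implicit Arguments. Unset Strict Implicit. Unset Printing Implicit Defensive.

(** * Counting the permutations that preserve the fibres of a map *)

Section FibrePermutations.
Variables (T V : finType) (f : T -> V).

(** The list [r] of movable fibres allows an induction on [r]; [r = enum V] frees them all. *)
Let fperm (r : seq V) : {set {perm T}} :=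
  [set s : {perm T} | [forall j, (f (s j) == f j) && ((f j \in r) || (s j == j))]].

Let fpermP r (s : {perm T}) :
  reflect (forall j, f (s j) = f j /\ (f j \notin r -> s j = j)) (s \in fperm r).
Proof.
rewrite inE; apply: (iffP forallP) => H j.
  have /andP[/eqP-> rj] := H j; split=> // nr.
  by move: rj; rewrite (negPf nr) => /eqP.
have [-> hj] := H j; rewrite eqxx /=; case: (boolP (f j \in r)) => //= nr.
by rewrite hj.
Qed.

Let fperm_group r : group_set (fperm r).
Proof.
apply/group_setP; split=> [|s t /fpermP hs /fpermP ht].
  by apply/fpermP=> j; rewrite perm1.
apply/fpermP=> j; rewrite permM; have [e1 e2] := hs j.
split=> [|nr]; first by rewrite (ht _).1.
by rewrite (e2 nr) (ht j).2.
Qed.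

(* The permutations moving only fibres over i :: r form the direct product of
   Sym (f @^-1 i) and of the permutations moving only fibres over r. *)
Let card_fperm r : uniq r ->
  #|fperm r| = (\prod_(i <- r) (#|[pred j | f j == i]|)`!)%N.
Proof.
elim: r => [_|i r IH /= /andP[ir ur]].
  rewrite big_nil (_ : fperm [::] = [set 1%g]) ?cards1 //.
  apply/setP=> s; rewrite [RHS]inE; apply/fpermP/eqP=> [H|-> j]; last by rewrite perm1.
  by apply/permP=> j; rewrite perm1 (H j).2.
pose A := [set j | f j == i].
have cA : #|[pred j | f j == i]| = #|A| by apply: eq_card => j; rewrite !inE.
rewrite big_cons cA -card_perm -IH //.
have -> : #|perm_on A| = #|Sym A| by apply: eq_card => s; rewrite !inE.
rewrite -(TI_cardMg (G := Sym A) (H := Group (fperm_group r))) /=; last first.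
  apply/setP=> s; rewrite finset.in_setI finset.in_set1 [s \in Sym A]inE.
  apply/andP/eqP => [[sA /fpermP sr]|->]; last first.
    by split; [exact: perm_on1 | apply/fpermP=> j; rewrite perm1].
  apply/permP=> j; rewrite perm1; have [jA|jA] := boolP (j \in A).
    by rewrite (sr j).2 //; move: jA; rewrite inE => /eqP->.
  exact: out_perm sA jA.
apply: eq_card => s; apply/fpermP/mulsgP => [hs|[u v]]; last first.
  rewrite inE => uA /fpermP hv -> j; rewrite permM.
  have fu : f (u j) = f j.
    have [jA|jA] := boolP (j \in A); last by rewrite (out_perm uA jA).
    have := perm_closed j uA; rewrite jA !inE => /eqP->.
    by move: jA; rewrite inE => /eqP->.
  rewrite (hv _).1 fu; split=> //; rewrite inE => /norP[fi fr].
  rewrite (hv _).2 ?fu //; apply: out_perm uA _.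
  by rewrite inE.
have nA : s \in 'N(A | 'P)%g.
  apply/astabsP => j; rewrite /= !inE apermE; by rewrite (hs j).1.
(* [u] is the part of [s] acting on the fibre [A]; the remaining factor fixes [A] pointwise. *)
pose u := restr_perm A s.
exists u (u^-1 * s)%g; last by rewrite mulKVg.
  by rewrite inE; apply: restr_perm_on.
have uA : perm_on A (u^-1)%g by apply/perm_onV/restr_perm_on.
apply/fpermP => j; rewrite permM.
have [jA|jA] := boolP (j \in A).
  have -> : s ((u^-1)%g j) = j.
    by rewrite -(@restr_permE _ A) ?permKV // perm_closed.
  by split.
rewrite (out_perm uA jA) (hs j).1; split=> // fr; apply: (hs j).2.
by rewrite inE negb_or fr andbT; move: jA; rewrite inE.
Qed.

Lemma card_perm_fibres :
  #|[set s : {perm T} | [forall j, f (s j) == f j]]| =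
  (\prod_i (#|[pred j | f j == i]|)`!)%N.
Proof.
rewrite -big_enum -(card_fperm (enum_uniq V)) //; apply: eq_card => s.
rewrite !inE; apply: eq_forallb => j; by rewrite mem_enum andbT.
Qed.

End FibrePermutations.

(** Equal fibre sizes make the value tuples of [f] and [g] equal as multisets. *)
Lemma perm_of_card_fibres (V : finType) n (f g : {ffun 'I_n -> V}) :
  (forall i, #|[pred j | f j == i]| = #|[pred j | g j == i]|) ->
  exists s : 'S_n, g =1 f \o s.
Proof.
move=> fg.
have cnt (h : {ffun 'I_n -> V}) i :
    count_mem i [tuple h j | j < n] = #|[pred j | h j == i]|.
  by rewrite count_map cardE [enum _]/enum_mem size_filter -enumT.
have /tuple_permP[s Hs] : perm_eq [tuple g j | j < n] [tuple f j | j < n].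
  by apply/allP => i _ /=; rewrite !cnt fg.
exists s => j.
have -> : g j = tnth [tuple g j | j < n] j by rewrite tnth_mktuple.
rewrite (tnth_nth (g j)) Hs -tnth_nth !tnth_mktuple //=.
Qed.

(** The solutions form a coset [s0 * H], where [s0] is one solution and [H] is the group of
    permutations preserving the fibres of [f]. *)
Lemma card_perm_match (V : finType) n (f g : {ffun 'I_n -> V}) :
  (forall i, #|[pred j | f j == i]| = #|[pred j | g j == i]|) ->
  #|[set s : 'S_n | [ffun j => f (s j)] == g]| =
  (\prod_i (#|[pred j | f j == i]|)`!)%N.
Proof.
move=> /perm_of_card_fibres[s0 gE]; rewrite -card_perm_fibres.
rewrite -[RHS](card_imset _ (mulgI s0)); apply: eq_card => s.
rewrite inE; apply/eqP/imsetP => [/ffunP sg|[t]].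
  exists (s0^-1 * s)%g; last by rewrite mulKVg.
  rewrite inE; apply/forallP => j; rewrite permM.
  by have := sg ((s0^-1)%g j); rewrite gE !ffunE /= permKV => ->.
rewrite inE => /forallP ft ->; apply/ffunP => j.
by rewrite ffunE gE /= permM (eqP (ft _)).
Qed.

(** Each rearrangement of [f] arises from equally many permutations. Their number is the bosonic
    factor in the square of a Fock amplitude. *)
Lemma sum_perm_comp (V : finType) (K : pzSemiRingType) n (f : {ffun 'I_n -> V})
    (G : {ffun 'I_n -> V} -> K) :
  (\prod_i (#|[pred j | f j == i]|)`!)%:R *
    \sum_(g : {ffun 'I_n -> V} |
      [forall i, #|[pred j | g j == i]| == #|[pred j | f j == i]|]) G g =
  \sum_(s : 'S_n) G [ffun j => f (s j)].
Proof.
rewrite big_distrr /=.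
rewrite [RHS](partition_big (fun s : 'S_n => [ffun j => f (s j)])
  (fun g : {ffun 'I_n -> V} =>
      [forall i, #|[pred j | g j == i]| == #|[pred j | f j == i]|])) /=; last first.
  move=> s _; apply/forallP => i; apply/eqP.
  rewrite -!sum1_card [RHS](reindex_perm s) /=.
  by apply: eq_bigl => j; rewrite !inE ffunE.
apply: eq_bigr => g /forallP fg.
rewrite (eq_bigr (fun=> G g)); last by move=> s /eqP <-.
rewrite -(card_perm_match (g := g)); last by move=> i; rewrite (eqP (fg i)).
rewrite sumr_const mulr_natl; congr (_ *+ _).
by apply: eq_card => s; rewrite !inE.
Qed.

(** * The permanent of I + y J and its linear coefficient *)

(** Expand over the set [J] of indices where [y] is chosen: a permutation survives iff it fixes
    every index outside [J], which leaves |J|! of them, and binomial(n, k) k! = n^_k. *)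
Lemma permanent_diag_const (K : comPzRingType) n (y : K) :
  \sum_(s : 'S_n) \prod_j ((j == s j)%:R + y) =
  \sum_(k < n.+1) (n ^_ k)%:R * y ^+ k.
Proof.
under eq_bigr => s _ do under eq_bigr => j _ do rewrite addrC.
under eq_bigr => s _ do rewrite bigA_distr.
rewrite exchange_big /=.
have E (J : {set 'I_n}) :
   \sum_(s : 'S_n) \prod_j (if j \in J then y else (j == s j)%:R) = (#|J|)`!%:R * y ^+ #|J|.
  rewrite -card_perm -(sum1_card (perm_on J)) natr_sum mulr_suml.
  rewrite [RHS]big_mkcond /=; apply: eq_bigr => s _.
  rewrite (bigID (mem J)) /=.
  rewrite (eq_bigr (fun=> y)); last by move=> j ->.
  rewrite prodr_const.
  rewrite (eq_bigr (fun j => (j == s j)%:R)); last by move=> j /negPf->.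
  case: ifPn => sJ.
    rewrite big1 ?mulr1 ?mul1r // => j jJ; by rewrite (out_perm sJ jJ) eqxx.
  move: sJ; rewrite /perm_on => /subsetPn[j]; rewrite inE => sj jJ.
  by rewrite (bigD1 j) //= eq_sym (negPf sj) mul0r mulr0.
rewrite (eq_bigr _ (fun J _ => E J)).
rewrite (partition_big (fun J : {set 'I_n} => inord #|J| : 'I_n.+1) predT) //=.
apply: eq_bigr => k _.
have cJ (J : {set 'I_n}) : (inord #|J| == k) = (#|J| == k).
  have lJ : (#|J| < n.+1)%N by rewrite ltnS -[n in leqRHS]card_ord max_card.
  by rewrite -val_eqE /= inordK.
rewrite (eq_bigl _ _ cJ).
rewrite (eq_bigr (fun=> k`!%:R * y ^+ k)); last by move=> J /eqP->.
rewrite sumr_const -(@eq_card _ [set J : {set 'I_n} | #|J| == k]);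
  last by move=> J; rewrite !inE.
by rewrite card_draws card_ord -mulrnAl -mulrnA mulnC bin_ffact.
Qed.

(** The coefficient of X in (X - 1)^k is its derivative at 0, k (-1)^(k - 1). The term k = 0
    contributes nothing, and j = k - 1. *)
Lemma coef1_permanent (K : comNzRingType) n (c : K) :
  (\sum_(k < n.+1) (n ^_ k)%:R * (('X - 1) * c%:P) ^+ k : {poly K})`_1 =
  \sum_(j < n) (n ^_ j.+1)%:R * j.+1%:R * (- 1) ^+ j * c ^+ j.+1.
Proof.
have E k : (('X - 1 : {poly K}) ^+ k)`_1 = k%:R * (-1) ^+ k.-1.
  have := coef_deriv (('X - 1 : {poly K}) ^+ k) 0.
  rewrite mulr1n => <-; rewrite deriv_exp derivB derivX -[1]/(1%:P) derivC subr0 ?mulr1 ?mul1r.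
  by rewrite coefMn -horner_coef0 horner_exp hornerXsubC sub0r mulr_natl.
rewrite coef_sum big_ord_recl expr0 mulr1 ffactn0 coef1 add0r.
apply: eq_bigr => j _.
rewrite lift0 exprMn -polyC_exp mulr_natl.
rewrite coefMn coefMC E.
by rewrite succnK -[LHS]mulr_natl !mulrA.
Qed.

(** * Alternating and plain moments for the weights (n - 1)^_j / n^j *)

Section AlternatingSum.
Variables (R : realFieldType) (n : nat).
Hypothesis n_gt0 : (0 < n)%N.

Definition ffact_ratio j : R := (n.-1 ^_ j)%:R / n%:R ^+ j.
Local Notation a := ffact_ratio.

Definition alternating_moment (p : R -> R) : R :=
  \sum_(j < n) (- 1) ^+ j * p j.+1%:R * a j.
Local Notation L := alternating_moment.

Definition moment (p : R -> R) : R := \sum_(j < n) p j.+1%:R * a j.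
Local Notation P := moment.

Let N : R := n%:R.
Let N_ge1 : 1 <= N. Proof. by rewrite ler1n. Qed.
Let N_gt0 : 0 < N. Proof. by rewrite ltr0n. Qed.
Let N_neq0 : N != 0. Proof. by rewrite pnatr_eq0 -lt0n. Qed.

Lemma ffact_ratio_ge0 j : 0 <= a j.
Proof. by rewrite divr_ge0 ?exprn_ge0 ?ler0n. Qed.

(** This kills the boundary term at [k = n] in both summations by parts. *)
Lemma ffact_ratio_last : a n = 0.
Proof. by rewrite /ffact_ratio ffact_small ?mul0r // prednK. Qed.

Lemma ffact_ratioS j : a j.+1 = a j - j.+1%:R * a j / N.
Proof.
rewrite /ffact_ratio ffactnSr natrM exprSr.
(* The truncated [n.-1 - j] is the true difference when [j < n]; otherwise both sides vanish. *)
have [jn|nj] := ltnP j n; last first.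
  by rewrite ffact_small ?prednK // !mul0r mulr0 !mul0r subr0.
have -> : (n.-1 - j)%:R = N - j.+1%:R :> R.
  by rewrite -subSS prednK // natrB.
have Nj : N ^+ j != 0 by rewrite expf_neq0.
by rewrite -/N; field; rewrite N_neq0.
Qed.

Lemma alternating_moment_shift (p : R -> R) :
  L (fun m => p m + p (m - 1)) = p 0 + L (fun m => m * p m) / N.
Proof.
suff H k : \sum_(j < k) (- 1) ^+ j * (p j.+1%:R + p (j.+1%:R - 1)) * a j =
    p 0 - (- 1) ^+ k * p k%:R * a k
    + (\sum_(j < k) (- 1) ^+ j * (j.+1%:R * p j.+1%:R) * a j) / N.
  by rewrite /alternating_moment H ffact_ratio_last mulr0 subr0.
elim: k => [|k IH].
  by rewrite !big_ord0 /ffact_ratio ffactn0 mul0r expr0 divr1 mulr1 mul1r subrr addr0.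
rewrite !big_ord_recr /= IH ffact_ratioS exprS.
have -> : k.+1%:R - 1 = k%:R :> R by rewrite -natr1 addrK.
by field; exact: N_neq0.
Qed.

(** Differencing lowers the degree, so a moment of degree d + 1 reduces to moments of degree at most
    d - 1 at the price of a factor n. *)
Lemma moment_shift (p : R -> R) :
  P (fun m => m * p m) = N * (p 0 + P (fun m => p m - p (m - 1))).
Proof.
suff H k : \sum_(j < k) (j.+1%:R * p j.+1%:R) * a j =
   N * (p 0 - p k%:R * a k + \sum_(j < k) (p j.+1%:R - p (j.+1%:R - 1)) * a j).
  by rewrite /moment H ffact_ratio_last mulr0 subr0.
elim: k => [|k IH].
  by rewrite !big_ord0 /ffact_ratio ffactn0 divr1 mulr1 subrr addr0 mulr0.
rewrite !big_ord_recr /= IH ffact_ratioS.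
have -> : k.+1%:R - 1 = k%:R :> R by rewrite -natr1 addrK.
by field; exact: N_neq0.
Qed.

Lemma moment_le (p q : R -> R) :
  (forall m, 1 <= m -> p m <= q m) -> P p <= P q.
Proof.
move=> pq; apply: ler_sum => j _; apply: ler_wpM2r; first exact: ffact_ratio_ge0.
by apply: pq; rewrite ler1n.
Qed.

Lemma momentZ (c : R) p : P (fun m => c * p m) = c * P p.
Proof. by rewrite /moment mulr_sumr; apply: eq_bigr => j _; rewrite mulrA. Qed.

Lemma norm_alternating_moment (p : R -> R) :
  (forall m, 1 <= m -> 0 <= p m) -> `|L p| <= P p.
Proof.
move=> p0; apply: le_trans (ler_norm_sum _ _ _) _; apply: ler_sum => j _.
rewrite normrM (ger0_norm (ffact_ratio_ge0 j)) normrM normrX normrN1 expr1n mul1r.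
by rewrite ger0_norm // p0 // ler1n.
Qed.

Lemma eq_alternating_moment p q : p =1 q -> L p = L q.
Proof. by move=> pq; apply: eq_bigr => j _; rewrite pq. Qed.

Lemma eq_moment p q : p =1 q -> P p = P q.
Proof. by move=> pq; apply: eq_bigr => j _; rewrite pq. Qed.

Lemma alternating_momentD p q : L (fun m => p m + q m) = L p + L q.
Proof.
rewrite /alternating_moment -big_split /=; apply: eq_bigr => j _; ring.
Qed.

Lemma alternating_momentZ c p : L (fun m => c * p m) = c * L p.
Proof.
rewrite /alternating_moment mulr_sumr; apply: eq_bigr => j _; ring.
Qed.

Lemma moment1 : P id = N.
Proof.
have := moment_shift (fun=> 1).
rewrite (@eq_moment _ id); last by move=> m; rewrite mulr1.
move=> ->; rewrite (_ : P _ = 0) ?addr0 ?mulr1 //.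
by rewrite /moment big1 // => j _; rewrite subrr mul0r.
Qed.

Lemma moment3_le : P (fun m => m ^+ 3) <= 2 * N ^+ 2.
Proof.
rewrite (@eq_moment _ (fun m => m * m ^+ 2)) // moment_shift expr0n add0r.
rewrite expr2 mulrCA ler_pM2l //.
rewrite -moment1 -momentZ; apply: moment_le => m m1 /=; nra.
Qed.

Lemma moment5_le : P (fun m => m ^+ 5) <= 8 * N ^+ 3.
Proof.
rewrite (@eq_moment _ (fun m => m * m ^+ 4)) // moment_shift expr0n add0r.
have -> : 8 * N ^+ 3 = N * (4 * (2 * N ^+ 2)) by ring.
rewrite ler_pM2l //.
apply: (@le_trans _ _ (4 * P (fun m => m ^+ 3))); last first.
  by rewrite ler_pM2l ?moment3_le.
rewrite -momentZ; apply: moment_le => m m1.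
suff : 0 <= 4 * m ^+ 3 - (m ^+ 4 - (m - 1) ^+ 4) by lra.
(* Expanded around m = 1, the gap has only positive coefficients. *)
have -> : 4 * m ^+ 3 - (m ^+ 4 - (m - 1) ^+ 4) =
   6 * (m - 1) ^+ 2 + 8 * (m - 1) + 3 by ring.
have := sqr_ge0 (m - 1); lra.
Qed.

Local Notation Lk k := (L (fun m => m ^+ k)).

(** Powers of m >= 1 grow with the exponent, so an even exponent can borrow the bound of the next
    odd one. *)
Lemma norm_alternating_monomial j k c : (j <= k)%N -> P (fun m => m ^+ k) <= c ->
  `|Lk j| <= c.
Proof.
move=> jk; apply: le_trans.
apply: (@le_trans _ _ (P (fun m => m ^+ j))).
  by apply: norm_alternating_moment => m m1; rewrite exprn_ge0 //; lra.
by apply: moment_le => m m1; exact: ler_weXn2l.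
Qed.

(** The polynomials used for [L1E] to [L4E] are E_k(m + 1) / 2, with E_k the Euler polynomial. Their
    values at 0 are the constants 1/4, 0, -1/8, 0. *)
Let L1E : Lk 1 = 1 / 4 + (Lk 2 / 2 + Lk 1 / 4) / N.
Proof.
have := alternating_moment_shift (fun m => m / 2 + 1 / 4).
rewrite (@eq_alternating_moment _ (fun m => m ^+ 1)); last by move=> m; field.
move=> {1}->; rewrite mul0r add0r; congr (_ + _ / _).
rewrite (@eq_alternating_moment _ (fun m => 2^-1 * m ^+ 2 + 4^-1 * m ^+ 1));
  last by move=> m; field.
by rewrite alternating_momentD !alternating_momentZ; field.
Qed.

Let L2E : Lk 2 = (Lk 3 / 2 + Lk 2 / 2) / N.
Proof.
have := alternating_moment_shift (fun m => m ^+ 2 / 2 + m / 2).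
rewrite (@eq_alternating_moment _ (fun m => m ^+ 2)); last by move=> m; field.
move=> {1}->; rewrite expr0n !mul0r !add0r; congr (_ / _).
rewrite (@eq_alternating_moment _ (fun m => 2^-1 * m ^+ 3 + 2^-1 * m ^+ 2));
  last by move=> m; field.
by rewrite alternating_momentD !alternating_momentZ; field.
Qed.

Let L3E : Lk 3 = - 1 / 8 + (Lk 4 / 2 + Lk 3 * 3 / 4 - Lk 1 / 8) / N.
Proof.
have := alternating_moment_shift (fun m => m ^+ 3 / 2 + m ^+ 2 * 3 / 4 - 1 / 8).
rewrite (@eq_alternating_moment _ (fun m => m ^+ 3)); last by move=> m; field.
move=> {1}->; rewrite !expr0n !mul0r !add0r; congr (_ + _ / _); first by rewrite mulNr.
rewrite (@eq_alternating_moment _ (fun m => 2^-1 * m ^+ 4 + (3 / 4 * m ^+ 3 + (- 8^-1) * m ^+ 1)));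
  last by move=> m; field.
by rewrite !alternating_momentD !alternating_momentZ; field.
Qed.

Let L4E : Lk 4 = (Lk 5 / 2 + Lk 4 - Lk 2 / 2) / N.
Proof.
have := alternating_moment_shift (fun m => m ^+ 4 / 2 + m ^+ 3 - m / 2).
rewrite (@eq_alternating_moment _ (fun m => m ^+ 4)); last by move=> m; field.
move=> {1}->; rewrite !expr0n !mul0r !add0r oppr0 add0r; congr (_ / _).
rewrite (@eq_alternating_moment _ (fun m => 2^-1 * m ^+ 5 + (1 * m ^+ 4 + (- 2^-1) * m ^+ 2)));
  last by move=> m; field.
by rewrite !alternating_momentD !alternating_momentZ; field.
Qed.

(** The crude bounds of orders N, N^2 and N^3 are improved downwards from exponent 4: [l4] is
    O(N^2), then [l3] is O(N), then [l2] and [l1] are O(1), and [e1] gains the last factor N. *)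
Lemma alternating_moment_quarter : `|L id - 1 / 4| <= 7 / N.
Proof.
have -> : L id = Lk 1 by [].
have N0 := N_gt0; have N1 := N_ge1.
have hP1 : P (fun m => m ^+ 1) <= N by rewrite -[leRHS]moment1.
have h1 := norm_alternating_monomial (leqnn 1) hP1.
have h2 := norm_alternating_monomial (isT : (2 <= 3)%N) moment3_le.
have h3 := norm_alternating_monomial (leqnn 3) moment3_le.
have h4 := norm_alternating_monomial (isT : (4 <= 5)%N) moment5_le.
have h5 := norm_alternating_monomial (leqnn 5) moment5_le.
move: L1E L2E L3E L4E h1 h2 h3 h4 h5.
move: (Lk 1) (Lk 2) (Lk 3) (Lk 4) (Lk 5) => l1 l2 l3 l4 l5.
move=> e1 e2 e3 e4; rewrite !ler_norml.
move=> /andP[h1 h1'] /andP[h2 h2'] /andP[h3 h3'] /andP[h4 h4'] /andP[h5 h5'].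
have {}e4 : N * l4 = l5 / 2 + l4 - l2 / 2 by rewrite {1}e4; field.
have {}e3 : N * (l3 + 1 / 8) = l4 / 2 + l3 * 3 / 4 - l1 / 8 by rewrite {1}e3; field.
have {}e2 : N * l2 = l3 / 2 + l2 / 2 by rewrite {1}e2; field.
have {}e1 : N * (l1 - 1 / 4) = l2 / 2 + l1 / 4 by rewrite {1}e1; field.
have div x c : N * x <= N * c -> x <= c by rewrite ler_pM2l.
have NN : N <= N ^+ 2 by rewrite expr2 ler_peMr //; lra.
have NNN : N ^+ 2 <= N ^+ 3 by rewrite exprS ler_peMl //; lra.
have b4 : l4 <= 13 * N ^+ 2.
  by apply: div; rewrite e4 mulrCA -exprS; lra.
have b4' : - l4 <= 13 * N ^+ 2.
  by apply: div; rewrite mulrN e4 mulrCA -exprS; lra.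
have b3 : l3 <= 9 * N.
  by apply: div; rewrite mulrCA -expr2; lra.
have b3' : - l3 <= 9 * N.
  by apply: div; rewrite mulrCA -expr2; lra.
(* The term l2 / 2 on the right of [e2] is absorbed through N - 1/2 >= N / 2. *)
have b2 : l2 <= 9 by nra.
have b2' : - l2 <= 9 by nra.
have b1 : l1 <= 7 by nra.
have b1' : - l1 <= 7 by nra.
apply/andP; split; first rewrite lerNl; rewrite ler_pdivlMr //.
  by rewrite mulNr mulrC e1; lra.
by rewrite mulrC e1; lra.
Qed.

End AlternatingSum.

(** * From Fock probabilities to a coefficient of a permanent *)

Section Heralding.
Variable R : realType.
Local Notation C := R[i].
Local Notation toC := (real_complex R).

Lemma abs2E (z : C) : toC (abs2 z) = z * z^*.
Proof.
case: z => a b; apply/eqP; rewrite eq_complex /=; apply/andP; split; apply/eqP.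
  by rewrite /abs2 /= mulrN opprK !expr2.
by rewrite mulrN mulrC addNr.
Qed.

Lemma conjC_real_complex (x : R) : (toC x)^* = toC x.
Proof. exact: conjc_real. Qed.

(** In a squared amplitude, [f] is the assignment from the amplitude and [f \o s] the one from its
    conjugate. *)
Definition pair_weight n (U : 'M[C]_n) (f : {ffun 'I_n -> 'I_n}) : C :=
  \sum_(s : 'S_n) \prod_j (U (f j) j * (U (f (s j)) j)^*).

Lemma fock_prob n (U : 'M[C]_n) (p : 'I_n -> nat) :
  toC (abs2 (fock_amp U p)) =
  \sum_(f : {ffun 'I_n -> 'I_n} | [forall i, occ f i == p i]) pair_weight U f.
Proof.
pose D : nat := (\prod_(i < n) (p i)`!)%N.
rewrite abs2E /fock_amp complexr0 rmorphM /= conjC_real_complex mulrACA.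
have -> : toC (Num.sqrt D%:R) * toC (Num.sqrt D%:R) = D%:R :> C.
  by rewrite -rmorphM -expr2 sqr_sqrtr ?ler0n // rmorph_nat.
rewrite mulrCA mulr_suml; apply: eq_bigr => f /forallP fp.
rewrite rmorph_sum mulr_sumr.
rewrite (eq_bigl (fun g => [forall i, occ g i == occ f i])); last first.
  by move=> g; apply: eq_forallb => i; rewrite (eqP (fp i)).
rewrite -mulr_sumr.
have -> : D = (\prod_i (#|[pred j | f j == i]|)`!)%N.
  by apply: eq_bigr => i _; rewrite -(eqP (fp i)).
rewrite (sum_perm_comp f (fun g => (\prod_j U (g j) j)^*)) mulr_sumr.
apply: eq_bigr => s _; rewrite rmorph_prod -big_split /=.
by apply: eq_bigr => j _; rewrite ffunE.
Qed.

Lemma occ_le n (f : {ffun 'I_n -> 'I_n}) i : (occ f i < n.+1)%N.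
Proof. by rewrite ltnS -[n in leqRHS]card_ord max_card. Qed.

Lemma heralding_rateE n (U : 'M[C]_n.+1) :
  toC (heralding_rate U) =
  \sum_(f : {ffun 'I_n.+1 -> 'I_n.+1} | occ f ord0 == 1%N) pair_weight U f.
Proof.
rewrite /heralding_rate rmorph_sum /=.
transitivity (\sum_(p : {ffun 'I_n.+1 -> 'I_n.+2} | pat p ord0 == 1%N)
   toC (abs2 (fock_amp U (pat p)))).
  rewrite [LHS]big_mkcond [RHS]big_mkcond; apply: eq_bigr => p _ /=.
  rewrite /ideal.
  have [->|amp0] := eqVneq (fock_amp U (pat p)) 0.
    by rewrite abs2E mul0r !if_same.
  have -> : [forall i : 'I_n.+1, (nat_of_ord i == 0%N) ==> (pat p i == 1%N)]
      = (pat p ord0 == 1%N).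
    apply/forallP/idP => [/(_ ord0)//|p0 i]; apply/implyP => /eqP i0.
    by rewrite (_ : i = ord0) //; apply: val_inj.
  have -> : (\sum_(i < n.+1) pat p i)%N == n.+1; last by rewrite andbT.
  (* Occupations of an assignment add up to the number of photons; for any other total the amplitude
     is an empty sum. *)
  apply: contra_neqT amp0 => sp; rewrite /fock_amp [X in _ * X]big_pred0 ?mulr0 // => f.
  apply/negP => /forallP fp; case/negP: sp.
  rewrite -(eq_bigr _ (fun i _ => eqP (fp i))) -[X in _ == X]card_ord -sum1_card.
  rewrite [X in _ == X](partition_big f predT) //=; apply/eqP/eq_bigr => i _.
  by rewrite /occ -sum1_card.
rewrite (eq_bigr _ (fun (p : {ffun _ -> _}) _ => fock_prob U (pat p))).
rewrite [RHS](partition_big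
  (fun f : {ffun 'I_n.+1 -> 'I_n.+1} => [ffun i => Ordinal (occ_le f i)])
  (fun p => pat p ord0 == 1%N)) /=; last by move=> f; rewrite /pat ffunE.
apply: eq_bigr => p p0; apply: eq_bigl => f.
apply/forallP/andP => [fp|[_ /eqP <-] i]; last by rewrite /pat ffunE.
split; first by rewrite (eqP (fp _)).
by apply/eqP/ffunP => i; rewrite ffunE; apply/val_inj/eqP/fp.
Qed.

(** Multiplying out the sums over modes turns the permanent into a sum over assignments [f], each
    weighted by X to the power [occ f ord0]. *)
Lemma rate_permanent n (U : 'M[C]_n.+1) : unitary U -> first_row_uniform U ->
  toC (heralding_rate U) =
  (\sum_(s : 'S_n.+1) \prod_j ((j == s j)%:R + ('X - 1) * (n.+1%:R^-1 : C)%:P) : {poly C})`_1.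
Proof.
move=> uU rU; rewrite heralding_rateE.
pose w j k i : {poly C} := 'X^(i == ord0) * (U i j * (U i k)^*)%:P.
have sum_w j k : \sum_i w j k i = (j == k)%:R + ('X - 1) * (n.+1%:R^-1 : C)%:P.
  have -> : \sum_i w j k i = \sum_i (U i j * (U i k)^*)%:P
      + ('X - 1) * (U ord0 j * (U ord0 k)^*)%:P.
    rewrite (bigD1 ord0) //= [in RHS](bigD1 ord0) //= addrAC; congr (_ + _).
      by rewrite /w eqxx expr1 mulrBl mul1r addrC subrK.
    by apply: eq_bigr => i /negPf i0; rewrite /w i0 expr0 mul1r.
  congr (_ + _ * _%:P).
    rewrite -rmorph_sum /= -(rmorph_nat (@polyC C)) /=; congr (_%:P).
    (* Summing over the row index needs orthonormal columns, hence the commuted product. *)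
    have /matrixP/(_ k j) := mulmx1C uU.
    rewrite !mxE eq_sym => <-; apply: eq_bigr => i _.
    by rewrite !mxE mulrC.
  rewrite !rU // complexr0 conjC_real_complex -rmorphM -expr2 exprVn sqr_sqrtr ?ler0n //.
  by rewrite fmorphV rmorph_nat.
transitivity ((\sum_(s : 'S_n.+1) \prod_j \sum_i w j ((s^-1)%g j) i)`_1); last first.
  rewrite (reindex_inj invg_inj) /=; apply: (congr1 (fun p : {poly C} => p`_1)).
  apply: eq_bigr => s _.
  by apply: eq_bigr => j _; rewrite invgK sum_w.
under [in RHS]eq_bigr => s _ do rewrite bigA_distr_bigA.
rewrite [in RHS]exchange_big /= coef_sum [LHS]big_mkcond; apply: eq_bigr => f _.
have E (s : 'S_n.+1) : \prod_j w j ((s^-1)%g j) (f j) =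
   'X^(occ f ord0) * (\prod_j (U (f j) j * (U (f (s j)) j)^*))%:P.
  rewrite big_split /= prodrXr; congr (_ * _).
    congr ('X^_); rewrite /occ -sum1_card [RHS]big_mkcond /=.
    by apply: eq_bigr => j _; rewrite inE; case: eqP.
  rewrite -rmorph_prod /=; congr (_%:P).
  rewrite big_split [RHS]big_split /=; congr (_ * _).
  by rewrite (reindex_perm s) /=; apply: eq_bigr => j _; rewrite permK.
rewrite (eq_bigr _ (fun s _ => E s)) -mulr_sumr -rmorph_sum coefXnM coefC /=.
by case: (occ f ord0) => [|[|m]].
Qed.
Lemma heralding_rate_alternating n (U : 'M[C]_n) : (0 < n)%N ->
  unitary U -> first_row_uniform U ->
  heralding_rate U = alternating_moment n id.
Proof.
case: n U => // n U _ uU rU; apply: complexI; rewrite /= rate_permanent //.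
rewrite permanent_diag_const coef1_permanent /alternating_moment rmorph_sum.
apply: eq_bigr => j _; rewrite /ffact_ratio !rmorphM /= fmorphV !rmorphXn /= rmorphN1 !rmorph_nat.
(* n^_(j + 1) = n (n - 1)^_j, and this n cancels one power of 1 / n. *)
rewrite ffactnS natrM exprS exprVn succnK.
by field; rewrite nat1r expf_neq0 pnatr_eq0.
Qed.
End Heralding.

(** * The closed form and the hypergeometric form *)

(** Substitute t = n - 1 - j: then (n - 1)! / t! = (n - 1)^_j, and the signs and powers of n combine
    to (-1)^j / n^j. *)
Lemma hclosedE (R : realType) n : (0 < n)%N -> hclosed R n = alternating_moment n id.
Proof.
case: n => // n _; rewrite /hclosed /alternating_moment mulr_sumr (reindex_inj rev_ord_inj).
apply: eq_bigr => j _ /=; rewrite subSS.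
have jn : (j <= n)%N by rewrite -ltnS.
have -> : (n.+1 - (n - j) = j.+1)%N by rewrite subSn ?leq_subr // subKn.
rewrite /ffact_ratio /= -(ffact_fact jn) natrM.
have -> : (- 1 / n.+1%:R) ^+ n = (- 1) ^+ j * (- 1) ^+ (n - j) /
    (n.+1%:R ^+ j * n.+1%:R ^+ (n - j)) :> R.
  by rewrite expr_div_n -!exprD subnKC.
have s2 : (- 1) ^+ (n - j) * (- 1) ^+ (n - j) = 1 :> R.
  by rewrite -expr2 sqrr_sign.
rewrite -[- n.+1%:R]mulN1r exprMn -[RHS]mulr1 -[X in _ = _ * X]s2; field.
by rewrite !expf_neq0 ?pnatr_eq0 ?gtn_eqF ?fact_gt0.
Qed.

(** (-(n - 1))_j = (-1)^j (n - 1)^_j vanishes for j >= n, so the series terminates, and (2)_j / j! =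
    j + 1. *)
Lemma hyp2F0E (R : realType) n N : (0 < n)%N -> (n <= N)%N ->
  hyp2F0_partial (- (n.-1)%:R) 2 (n%:R)^-1 N = alternating_moment n id :> R.
Proof.
case: n => // n _ nN; rewrite /hyp2F0_partial /alternating_moment /=.
have pn j : pochhammer (- n%:R : R) j = (-1) ^+ j * (n ^_ j)%:R.
  rewrite /pochhammer; elim: j => [|j IH]; first by rewrite big_ord0 expr0 mul1r.
  rewrite big_ord_recr /= IH exprS ffactnSr.
  have [jn|nj] := leqP j n; last by rewrite ffact_small // mul0n !mulr0 mul0r.
  by rewrite natrM natrB //; ring.
have p2 j : pochhammer (2 : R) j = j.+1`!%:R.
  rewrite /pochhammer; elim: j => [|j IH]; first by rewrite big_ord0.
  by rewrite big_ord_recr /= IH [in RHS]factS natrM -natrD mulrC.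
rewrite (big_ord_widen _ (fun j => (-1) ^+ j * j.+1%:R * ffact_ratio R n.+1 j) nN).
rewrite [RHS]big_mkcond /=; apply: eq_bigr => j _.
rewrite pn p2 /ffact_ratio /=.
case: ltnP => nj; last by rewrite ffact_small // mulr0 !mul0r.
rewrite factS natrM exprVn. by field; rewrite expf_neq0 ?pnatr_eq0 ?gtn_eqF ?fact_gt0.
Qed.

Local Open Scope classical_set_scope.

Theorem theorem3 (R : realType) :
  (forall (n : nat) (U : 'M[R[i]]_n),
     (2 < n)%N -> unitary U -> first_row_uniform U ->
     heralding_rate U = hclosed R n /\
     (forall N : nat, (n <= N)%N ->
        hclosed R n = hyp2F0_partial (- (n.-1)%:R) 2 (n%:R)^-1 N))
  /\
  (forall U : forall n : nat, 'M[R[i]]_n,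
     (forall n : nat, (2 < n)%N -> unitary (U n) /\ first_row_uniform (U n)) ->
     (fun n => heralding_rate (U n)) @ \oo --> (1 / 4 : R)).
Proof.
split=> [n U n2 uU rU|U UP].
  have n0 : (0 < n)%N by apply: leq_trans n2.
  split=> [|N nN]; first by rewrite hclosedE // heralding_rate_alternating.
  by rewrite hclosedE // hyp2F0E.
have bound n : (2 < n)%N -> `|1 / 4 - heralding_rate (U n)| <= 7 / n%:R.
  move=> n2; have n0 : (0 < n)%N by apply: leq_trans n2.
  have [uU rU] := UP n n2; rewrite heralding_rate_alternating // distrC.
  exact: alternating_moment_quarter.
apply/cvgrPdist_le => e e0; near=> n.
have n2 : (2 < n)%N by near: n; exists 3%N.
apply: le_trans (bound n n2) _.
rewrite ler_pdivrMr ?ltr0n ?(leq_trans _ n2) // mulrC -ler_pdivrMr //.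
near: n; exact: nbhs_infty_ger.
Unshelve. all: by end_near.
Qed.
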